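(* Let $n=n_1+n_2$ and $d=d_1+d_2$ be integers with $n_i\ge 2$ and $d_i\ge 1$ ($i=1,2$). Let $V$ be a complex vector space of dimension $d+1$, and let $V_1,V_2\subseteq V$ be linear subspaces in general position with $\dim V_i=d_i+1$, so that $V_1+V_2=V$ and $V_1\cap V_2=\mathbb{C}q$ is a line spanned by a vector $q\neq 0$ (equivalently, $\mathbb{P}^{d_1},\mathbb{P}^{d_2}\subseteq\mathbb{P}^d$ are generic linear subspaces, meeting in the single point $[q]$). Let $\underline c=(c_1,\dots,c_n)\in\Delta(d+1,n)$ satisfy $$d_1\le \sum_{i=1}^{n_1}c_i\le d_1+1\quad\text{and}\quad d_2\le\sum_{i=n_1+1}^{n}c_i\le d_2+1,$$ and set $$\underline c':=\Bigl(c_1,\dots,c_{n_1},\bigl(\textstyle\sum_{i=n_1+1}^n c_i\bigr)-d_2\Bigr),\qquad \underline c'':=\Bigl(c_{n_1+1},\dots,c_n,\bigl(\textstyle\sum_{i=1}^{n_1}c_i\bigr)-d_1\Bigr).$$ Then the restriction of any multidegree $\underline c$ invariant of $n$ points in $\mathbb{P}^d$ to configurations whose first $n_1$ points lie in $\mathbb{P}^{d_1}$ and whose last $n_2$ points lie in $\mathbb{P}^{d_2}$ lies in the tensor product of the multidegree $\underline c'$ invariants for $\mathbb{P}^{d_1}$ and the multidegree $\underline c''$ invariants for $\mathbb{P}^{d_2}$, where the attaching point $[q]$ is inserted as the last point of each configuration. Explicitly: for every positive integer $k$ with $k\underline c\in\mathbb{Z}^n$ and every $f\in T(V,k\underline c)$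 there is $F\in T(V_1,k\underline c')\otimes T(V_2,k\underline c'')$ such that $$f(v_1,\dots,v_n)=F\bigl((v_1,\dots,v_{n_1},q),(v_{n_1+1},\dots,v_n,q)\bigr)$$ for all $v_1,\dots,v_{n_1}\in V_1$ and $v_{n_1+1},\dots,v_n\in V_2$.
   Context: $\Delta(d+1,n)=\{(c_1,\dots,c_n)\in\mathbb{Q}^n\mid 0\le c_i\le 1,\ \sum c_i=d+1\}$. For a finite-dimensional complex vector space $W$ and $\underline k\in\mathbb{Z}_{\ge0}^m$, let $T(W,\underline k)$ be the space of functions $f:W^m\to\mathbb{C}$ that are polynomial, homogeneous of degree $k_i$ in the $i$-th argument for each $i$, and invariant under the diagonal action of $\mathrm{SL}(W)$; equivalently $T(W,\underline k)=\mathrm{H}^0(\mathbb{P}(W)^m,\mathcal{O}(k_1,\dots,k_m))^{\mathrm{SL}(W)}$. When $\underline c$ is only rational, ''multidegree $\underline c$ invariants'' refers to multidegree $k\underline c$ for positive integers $k$ clearing denominators (everything is invariant under scaling). An element of $T(W_1,\underline k_1)\otimes T(W_2,\underline k_2)$ is viewed as a function on $W_1^{m_1}\times W_2^{m_2}$. Note $k\underline c'$ and $k\underline c''$ are integral if $k\underline c$ is. *)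

(* Defs.v *)
From HB Require Import structures.
From mathcomp Require Import all_boot all_order all_algebra.
From mathcomp Require Import complex reals mpoly.

Set Implicit Arguments.
Unset Strict Implicit.
Unset Printing Implicit Defensive.

Import Order.TTheory GRing.Theory Num.Theory.
Local Open Scope ring_scope.

(* A point of [W^m] is a row ['rV[W]_m] of [m] vectors. *)
Section Invariants.
Variables (K : fieldType) (W : vectType K) (m : nat).
Implicit Types (f : 'rV[W]_m -> K) (v : 'rV[W]_m).

Definition coords v : 'rV[K]_(m * \dim {:W}) :=
  mxvec (\matrix_(i < m) passmx.rVof (vbasis {:W}) (v 0 i)).

(* The choice of basis is immaterial. *)
Definition polynomial_fun f :=
  exists p : {mpoly K[m * \dim {:W}]}, forall v, f v = p.@[coords v 0].

Definition scale_arg (i : 'I_m) (t : K) v : 'rV[W]_m :=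
  \row_j (if j == i then t *: v 0 j else v 0 j).

Definition multihomogeneous (a : 'I_m -> nat) f :=
  forall (i : 'I_m) (t : K) v, f (scale_arg i t v) = t ^+ a i * f v.

Definition det_end (g : 'End(W)) : K :=
  \det (passmx.mxof (vbasis {:W}) (vbasis {:W}) g).

Definition SL_invariant f :=
  forall g : 'End(W), det_end g = 1 -> forall v, f (map_mx g v) = f v.

(* Membership in the space $T(W, a)$ of multidegree-$a$ invariants. *)
Definition multidegree_invariant (a : 'I_m -> nat) f :=
  [/\ polynomial_fun f, multihomogeneous a f & SL_invariant f].

End Invariants.

(* Membership in the tensor product of two spaces of functions [P1] and [P2],
   whose elements are viewed as functions of two arguments. *)
Definition in_tensor (K : fieldType) (X Y : Type)
    (P1 : (X -> K) -> Prop) (P2 : (Y -> K) -> Prop) (F : X -> Y -> K) :=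
  exists (r : nat) (F1 : 'I_r -> X -> K) (F2 : 'I_r -> Y -> K),
    [/\ forall s, P1 (F1 s), forall s, P2 (F2 s)
      & forall x y, F x y = \sum_(s < r) F1 s x * F2 s y].

(* $\Delta(e, n)$ *)
Definition hypersimplex (e n : nat) (c : 'rV[rat]_n) :=
  (forall i, 0 <= c 0 i <= 1) /\ \sum_i c 0 i = e%:R.

(* The multidegree $k\underline c$. The truncation only serves to land in [nat]:
   it is exact when $k\underline c$ is nonnegative and integral, and
   [multideg_attach_left] and [multideg_attach_right] check this for the
   derived weights below. *)
Definition multideg n (k : nat) (c : 'rV[rat]_n) (i : 'I_n) : nat :=
  Num.truncn (k%:R * c 0 i).

Section Attach.
Variables (n1 n2 d1 d2 : nat) (c : 'rV[rat]_(n1 + n2)).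

Definition attach_left : 'rV[rat]_(n1 + 1) :=
  row_mx (lsubmx c) (const_mx (\sum_i rsubmx c 0 i - d2%:R)).

Definition attach_right : 'rV[rat]_(n2 + 1) :=
  row_mx (rsubmx c) (const_mx (\sum_i lsubmx c 0 i - d1%:R)).

End Attach.

Lemma multidegE n (k : nat) (c : 'rV[rat]_n) i :
  0 <= c 0 i -> k%:R * c 0 i \is a Num.int ->
  (multideg k c i)%:R = k%:R * c 0 i.
Proof.
by move=> c0 ck; apply: truncnK; rewrite natrEint ck mulr_ge0.
Qed.

Lemma multideg_attach_left n1 n2 d2 k (c : 'rV[rat]_(n1 + n2)) i :
  (forall j, 0 <= c 0 j) -> (forall j, k%:R * c 0 j \is a Num.int) ->
  d2%:R <= \sum_j rsubmx c 0 j ->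
  (multideg k (attach_left d2 c) i)%:R = k%:R * attach_left d2 c 0 i.
Proof.
move=> c0 ck hd; apply: multidegE; rewrite /attach_left mxE; case: split => j;
  rewrite !mxE ?subr_ge0 //.
rewrite mulrBr; apply: rpredB; last by rewrite rpredM ?rpred_nat.
by rewrite mulr_sumr; apply: rpred_sum => l _; rewrite mxE.
Qed.

Lemma multideg_attach_right n1 n2 d1 k (c : 'rV[rat]_(n1 + n2)) i :
  (forall j, 0 <= c 0 j) -> (forall j, k%:R * c 0 j \is a Num.int) ->
  d1%:R <= \sum_j lsubmx c 0 j ->
  (multideg k (attach_right d1 c) i)%:R = k%:R * attach_right d1 c 0 i.
Proof.
move=> c0 ck hd; apply: multidegE; rewrite /attach_right mxE; case: split => j;
  rewrite !mxE ?subr_ge0 //.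
rewrite mulrBr; apply: rpredB; last by rewrite rpredM ?rpred_nat.
by rewrite mulr_sumr; apply: rpred_sum => l _; rewrite mxE.
Qed.

(* Main.v *)
(* Restrict f to a function H(v, w) of v in V1^n1 and w in V2^n2.  An element of
   SL(V1) that multiplies q by u, rescaled and glued to a homothety of V2, gives
   an element of SL(V); hence each section H(., w) is invariant under the
   stabilizer of q in SL(V1), and picks up a power of u under the stabilizer of
   the line of q.  A function h with this property extends uniquely to an
   SL(V1)-invariant F with F(g v, g q) = h(v): since dim V1 >= 2, two
   transvection charts of the orbit of q suffice, in which F is polynomial
   divided by a power of a linear form, and the two forms are coprime.
   Finally H has finite rank, and a kernel of finite rank is a bilinear
   expression in finitely many of its own sections H(., w_i) and H(v_j, .), so
   extending these sections extends H to an element of the tensor product.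
   This avoids the first fundamental theorem of invariant theory. *)
From HB Require Import structures.
Require Import Defs.
From mathcomp Require Import all_boot all_order all_algebra.
From mathcomp Require Import complex reals mpoly.
From mathcomp Require Import ring boolp.

Set Implicit Arguments.
Unset Strict Implicit.
Unset Printing Implicit Defensive.

Import Order.TTheory GRing.Theory Num.Theory.
Local Open Scope ring_scope.

(** * Polynomial functions *)

Section LinearForms.
Variables (K : fieldType) (W : vectType K).

(* Keeps the values of a linear form in [K] rather than in [K^o]. *)
Definition form_val (l : 'Hom(W, K^o)) (x : W) : K := l x.

Implicit Types (l : 'Hom(W, K^o)) (x y : W).

Lemma form_valD l x y : form_val l (x + y) = form_val l x + form_val l y.
Proof. by rewrite /form_val linearD. Qed.

Lemma form_valB l x y : form_val l (x - y) = form_val l x - form_val l y.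
Proof. by rewrite /form_val linearB. Qed.

Lemma form_valZ l (a : K) x : form_val l (a *: x) = a * form_val l x.
Proof. by rewrite /form_val linearZ. Qed.

Lemma form_val_sum l (I : Type) (r : seq I) (F : I -> W) :
  form_val l (\sum_(i <- r) F i) = \sum_(i <- r) form_val l (F i).
Proof. by rewrite /form_val linear_sum. Qed.

Lemma form_val_subl l l' x : form_val (l - l') x = form_val l x - form_val l' x.
Proof. by rewrite /form_val add_lfunE opp_lfunE. Qed.

Lemma form_val_comp l (g : 'End(W)) x :
  form_val (l \o g)%VF x = form_val l (g x).
Proof. by rewrite /form_val comp_lfunE. Qed.

Definition coord_form (j : 'I_(\dim {:W})) : 'Hom(W, K^o) :=
  linfun (coord (vbasis {:W}) j : W -> K^o).

Lemma coord_formE j x : form_val (coord_form j) x = coord (vbasis {:W}) j x.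
Proof. by rewrite /form_val lfunE. Qed.

Lemma coord_form_sum x :
  x = \sum_j form_val (coord_form j) x *: (vbasis {:W})`_j.
Proof.
rewrite [LHS](coord_vbasis (memvf x)).
by apply: eq_bigr => j _; rewrite coord_formE.
Qed.

End LinearForms.

Section PolynomialFunctions.
Variables (K : fieldType) (W : vectType K) (m : nat).
Implicit Types (f g : 'rV[W]_m -> K) (v : 'rV[W]_m).

Lemma coords_mxvec_index v i j :
  coords v 0 (mxvec_index i j) = form_val (coord_form j) (v 0 i).
Proof. by rewrite /coords mxvecE !mxE coord_formE. Qed.

Lemma polynomial_fun_ext f g :
  f =1 g -> polynomial_fun f -> polynomial_fun g.
Proof. by move=> fg [p fE]; exists p => v; rewrite -fg. Qed.

Lemma polynomial_fun_const (a : K) : polynomial_fun (fun _ : 'rV[W]_m => a).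
Proof. by exists a%:MP => v; rewrite mevalC. Qed.

Lemma polynomial_funD f g : polynomial_fun f -> polynomial_fun g ->
  polynomial_fun (fun v => f v + g v).
Proof. by move=> [p pE] [r rE]; exists (p + r) => v; rewrite mevalD pE rE. Qed.

Lemma polynomial_funM f g : polynomial_fun f -> polynomial_fun g ->
  polynomial_fun (fun v => f v * g v).
Proof. by move=> [p pE] [r rE]; exists (p * r) => v; rewrite mevalM pE rE. Qed.

Lemma polynomial_funB f g : polynomial_fun f -> polynomial_fun g ->
  polynomial_fun (fun v => f v - g v).
Proof. by move=> [p pE] [r rE]; exists (p - r) => v; rewrite mevalB pE rE. Qed.

Lemma polynomial_funX f n : polynomial_fun f -> polynomial_fun (fun v => f v ^+ n).
Proof.
by move=> [p pE]; exists (p ^+ n) => v; rewrite rmorphXn /= pE.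
Qed.

Lemma polynomial_fun_sum (I : Type) (r : seq I) (F : I -> 'rV[W]_m -> K) :
  (forall i, polynomial_fun (F i)) ->
  polynomial_fun (fun v => \sum_(i <- r) F i v).
Proof.
move=> Fpoly; elim: r => [|i r IHr].
  apply: (@polynomial_fun_ext (fun=> 0)); first by move=> v; rewrite big_nil.
  exact: polynomial_fun_const.
apply: (@polynomial_fun_ext (fun v => F i v + \sum_(j <- r) F j v)).
  by move=> v; rewrite big_cons.
exact: polynomial_funD.
Qed.

Lemma polynomial_fun_form (l : 'Hom(W, K^o)) i :
  polynomial_fun (fun v => form_val l (v 0 i)).
Proof.
exists (\sum_(j < \dim {:W}) form_val l (vbasis {:W})`_j *: 'X_(mxvec_index i j)) => v.
rewrite [in LHS](coord_form_sum (v 0 i)) form_val_sum.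
rewrite (raddf_sum (meval _)) /=; apply: eq_bigr => j _.
by rewrite mevalZ mevalXU form_valZ coords_mxvec_index mulrC.
Qed.

(** Every coordinate in [coords v] is a linear form in one argument, so constants and such forms
    generate all polynomial functions under sums and products. This induction principle hides the
    multivariate polynomials from the rest of the proof; the sum and product cases also receive
    polynomiality of both operands. *)
Lemma polynomial_fun_ind (P : ('rV[W]_m -> K) -> Prop) :
  (forall f g, f =1 g -> P f -> P g) ->
  (forall a, P (fun=> a)) ->
  (forall i l, P (fun v => form_val l (v 0 i))) ->
  (forall f g, polynomial_fun f -> polynomial_fun g ->
     P f -> P g -> P (fun v => f v + g v)) ->
  (forall f g, polynomial_fun f -> polynomial_fun g ->
     P f -> P g -> P (fun v => f v * g v)) ->
  forall f, polynomial_fun f -> P f.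
Proof.
move=> Pext Pc Pl PD PM f [p fE].
suff Pp (r : {mpoly K[m * \dim {:W}]}) : P (fun v => r.@[coords v 0]).
  by apply: (Pext) (Pp p) => v.
have pf (r' : {mpoly K[m * \dim {:W}]}) :
  polynomial_fun (fun v => r'.@[coords v 0]) by exists r'.
have PXi k : P (fun v => ('X_k).@[coords v 0]).
  case/mxvec_indexP: k => i j.
  apply: (Pext) (Pl i (coord_form j)) => v.
  by rewrite mevalXU coords_mxvec_index.
have PX (n : 'X_{1..m * \dim {:W}}) : P (fun v => ('X_[n]).@[coords v 0]).
  rewrite mpolyXE_id.
  elim/big_rec: _ => [|i q _ IHq].
    by apply: (Pext) (Pc 1) => v; rewrite meval1.
  apply: (Pext (fun v => ('X_i ^+ n i).@[coords v 0] * q.@[coords v 0])).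
    by move=> v; rewrite mevalM.
  apply: (PM) => //; elim: (n i) => [|t IHt].
    by apply: (Pext) (Pc 1) => v; rewrite expr0 meval1.
  apply: (Pext (fun v => ('X_i).@[coords v 0] * ('X_i ^+ t).@[coords v 0])).
    by move=> v; rewrite exprS mevalM.
  exact: (PM).
elim/mpolyind: r => [|a n r _ _ IHr].
  by apply: (Pext) (Pc 0) => v; rewrite meval0.
apply: (Pext (fun v => a * ('X_[n]).@[coords v 0] + r.@[coords v 0])).
  by move=> v; rewrite mevalD mevalZ.
apply: (PD) => //; last by apply: (PM) => //; exists a%:MP => v; rewrite mevalC.
by exists (a *: 'X_[n]) => v; rewrite mevalZ.
Qed.

End PolynomialFunctions.

(** Testing against all linear forms of the target avoids fixing a basis there. *)
Definition polynomial_map (K : fieldType) (W W' : vectType K) m m'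
    (phi : 'rV[W]_m -> 'rV[W']_m') :=
  forall (l : 'Hom(W', K^o)) i, polynomial_fun (fun v => form_val l (phi v 0 i)).

Lemma polynomial_fun_comp (K : fieldType) (W W' : vectType K) m m'
    (phi : 'rV[W]_m -> 'rV[W']_m') (f : 'rV[W']_m' -> K) :
  polynomial_map phi -> polynomial_fun f -> polynomial_fun (f \o phi).
Proof.
move=> phiP; elim/polynomial_fun_ind: f / => [f g fg||i l|f g _ _|f g _ _].
- by apply: polynomial_fun_ext => v; rewrite /= fg.
- exact: polynomial_fun_const.
- exact: phiP.
- exact: polynomial_funD.
- exact: polynomial_funM.
Qed.

(** * Identity principle for polynomial functions *)

Section Density.
Variables (K : numFieldType) (W : vectType K) (m : nat).
Implicit Types (f g : 'rV[W]_m -> K) (v z : 'rV[W]_m).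

Lemma polynomial_fun_line f v z :
  polynomial_fun f -> exists p : {poly K}, forall t, f (v + map_mx ( *:%R t) z) = p.[t].
Proof.
elim/polynomial_fun_ind: f / => [f g fg [p pE]|a|i l|f g _ _ [p pE] [r rE]
  |f g _ _ [p pE] [r rE]].
- by exists p => t; rewrite -fg.
- by exists a%:P => t; rewrite hornerC.
- exists ((form_val l (v 0 i))%:P + (form_val l (z 0 i)) *: 'X) => t.
  by rewrite !mxE form_valD form_valZ hornerD hornerC hornerZ hornerX mulrC.
- by exists (p + r) => t; rewrite pE rE hornerD.
- by exists (p * r) => t; rewrite pE rE hornerM.
Qed.

(** In characteristic zero the integers from 1 to [size p] are distinct nonzero roots, more than a
    nonzero [p] can have. *)
Lemma poly_eq0_off0 (p : {poly K}) : (forall t, t != 0 -> p.[t] = 0) -> p = 0.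
Proof.
move=> p0; apply/eqP; apply: contraT => pn0.
pose s := [seq i.+1%:R : K | i <- iota 0 (size p)].
have /(max_poly_roots pn0) : all (root p) s.
  by apply/allP => _ /mapP[i _ ->]; rewrite /root p0 // pnatr_eq0.
rewrite size_map size_iota ltnn => -> //.
by rewrite map_inj_uniq ?iota_uniq // => i j /eqP; rewrite eqr_nat => /eqP[].
Qed.

(** Restrict both functions to the line from a point [v] with [f v != 0] to an arbitrary point [z].
    The two univariate restrictions have product zero, and that of [f] is nonzero at parameter 0, so
    that of [g] vanishes, in particular at parameter 1. *)
Lemma polynomial_fun_integral f g : polynomial_fun f -> polynomial_fun g ->
  (exists v, f v != 0) -> (forall v, f v * g v = 0) -> forall v, g v = 0.
Proof.
move=> fP gP [v fv] fg z.
have [p pE] := polynomial_fun_line v (z - v) fP.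
have [r rE] := polynomial_fun_line v (z - v) gP.
have /eqP : p * r = 0.
  by apply: poly_eq0_off0 => t _; rewrite hornerM -pE -rE fg.
rewrite mulf_eq0 => /orP[/eqP p0|/eqP r0].
  case/eqP: fv; have vE : v + map_mx ( *:%R 0) (z - v) = v.
    by apply/rowP => j; rewrite !mxE scale0r addr0.
  by move: (pE 0); rewrite vE p0 horner0.
have zE : v + map_mx ( *:%R 1) (z - v) = z.
  by apply/rowP => j; rewrite !mxE scale1r addrC subrK.
by move: (rE 1); rewrite zE r0 horner0.
Qed.

(** Algebraic form of Zariski density of the locus [a != 0]: the product of [a] and [f - g] vanishes
    everywhere, and polynomial functions have no zero divisors. *)
Lemma polynomial_fun_dense (a f g : 'rV[W]_m -> K) :
  polynomial_fun a -> polynomial_fun f -> polynomial_fun g ->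
  (exists v, a v != 0) -> (forall v, a v != 0 -> f v = g v) -> f =1 g.
Proof.
move=> aP fP gP a0 fg v; apply/eqP; rewrite -subr_eq0; apply/eqP; move: v.
refine (polynomial_fun_integral aP (polynomial_funB fP gP) a0 _).
move=> v; have [-> | /fg ->] := eqVneq (a v) 0; first by rewrite mul0r.
by rewrite subrr mulr0.
Qed.

End Density.

(** * Divisibility by powers of a linear form in one argument *)

Section Division.
Variables (K : numFieldType) (W : vectType K) (m : nat).
Variables (i : 'I_m) (a : 'Hom(W, K^o)) (e : W).
Hypothesis ae : form_val a e = 1.
Implicit Types (f g : 'rV[W]_m -> K) (v : 'rV[W]_m).

Let a_ v := form_val a (v 0 i).

(** Projection of the [i]-th argument onto the hyperplane [a = 0] along [e]. *)
Definition hyper_proj v : 'rV[W]_m :=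
  \row_j (if j == i then v 0 j - a_ v *: e else v 0 j).

Lemma polynomial_map_hyper_proj : polynomial_map hyper_proj.
Proof.
move=> l j; case: (eqVneq j i) => [->|ji].
  apply: (@polynomial_fun_ext _ _ _
    (fun v => form_val l (v 0 i) - form_val a (v 0 i) * form_val l e)).
    by move=> v; rewrite mxE eqxx form_valB form_valZ.
  apply: polynomial_funB; first exact: polynomial_fun_form.
  apply: polynomial_funM; first exact: polynomial_fun_form.
  exact: polynomial_fun_const.
apply: polynomial_fun_ext (polynomial_fun_form l j) => v.
by rewrite mxE (negPf ji).
Qed.

Lemma hyper_proj_form v : form_val a (hyper_proj v 0 i) = 0.
Proof. by rewrite mxE eqxx form_valB form_valZ ae mulr1 subrr. Qed.

(** Division with remainder by [a_], the remainder being the restriction to the hyperplane. The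
    quotients are built by induction; for a product they combine by a Leibniz rule. *)
Lemma polynomial_fun_hyper_proj f : polynomial_fun f ->
  exists2 g, polynomial_fun g &
    forall v, f v = f (hyper_proj v) + a_ v * g v.
Proof.
elim/polynomial_fun_ind: f / => [f g fg [h hP hE]|c|j l
    |f g fP gP [h hP hE] [k kP kE]|f g fP gP [h hP hE] [k kP kE]].
- by exists h => // v; rewrite -!fg.
- exists (fun=> 0); first exact: polynomial_fun_const.
  by move=> v; rewrite mulr0 addr0.
- exists (fun=> if j == i then form_val l e else 0).
    exact: polynomial_fun_const.
  move=> v; rewrite mxE; case: eqP => [->|_]; last by rewrite mulr0 addr0.
  by rewrite form_valB form_valZ subrK.
- exists (fun v => h v + k v); first exact: polynomial_funD.
  by move=> v; rewrite hE kE; ring.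
- exists (fun v => h v * g v + f (hyper_proj v) * k v).
    apply: polynomial_funD; first exact: polynomial_funM.
    apply: polynomial_funM => //.
    exact: (polynomial_fun_comp polynomial_map_hyper_proj).
  by move=> v; rewrite [f v]hE [in RHS](kE v) [g v]kE; ring.
Qed.

Lemma form_arg_neq0 : exists v, a_ v != 0.
Proof. by exists (const_mx e); rewrite /a_ mxE ae oner_neq0. Qed.

(** The vector [e'] witnesses that [b] does not vanish identically on the hyperplane [a = 0], so the
    two forms are coprime. Powers of [a] are split off [f] one at a time, with [N] fixed. *)
Lemma form_exp_dvd (b : 'Hom(W, K^o)) (e' : W) M N (f g : 'rV[W]_m -> K) :
  form_val a e' = 0 -> form_val b e' != 0 ->
  polynomial_fun f -> polynomial_fun g ->
  (forall v, form_val b (v 0 i) ^+ N * f v = a_ v ^+ M * g v) ->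
  exists2 h, polynomial_fun h & forall v, f v = a_ v ^+ M * h v.
Proof.
move=> ae' be'; elim: M f => [|M IHM] f fP gP fgE.
  by exists f => // v; rewrite expr0 mul1r.
have bP : polynomial_fun (fun v : 'rV[W]_m => form_val b (v 0 i) ^+ N).
  by apply: polynomial_funX; apply: polynomial_fun_form.
have pfc h : polynomial_fun h -> polynomial_fun (h \o hyper_proj).
  exact: (polynomial_fun_comp polynomial_map_hyper_proj).
(* On the hyperplane the right side has a zero factor, while the power of [b] is not identically
   zero there. *)
have f0 v : f (hyper_proj v) = 0.
  move: v; apply: (polynomial_fun_integral (pfc _ bP) (pfc _ fP)).
    exists (const_mx e'); rewrite /= mxE eqxx /a_ mxE ae' scale0r subr0.
    by rewrite expf_neq0.
  by move=> v /=; rewrite fgE /a_ hyper_proj_form exprS mul0r mul0r.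
have [h hP fE] : exists2 h, polynomial_fun h & forall v, f v = a_ v * h v.
  have [h hP hE] := polynomial_fun_hyper_proj fP.
  by exists h => // v; rewrite hE f0 add0r.
have aP : polynomial_fun a_ by apply: polynomial_fun_form.
have [|k kP kE] := IHM h hP gP.
  apply: (polynomial_fun_dense aP).
  - exact: polynomial_funM.
  - by apply: polynomial_funM => //; apply: polynomial_funX.
  - exact: form_arg_neq0.
  move=> v av; apply: (mulfI av).
  by rewrite mulrCA -fE fgE exprS -mulrA.
by exists k => // v; rewrite fE kE exprS mulrA.
Qed.

End Division.

(** * The special linear group and transvections *)

(* Sylvester's identity *)
Lemma det_addmul (K : comNzRingType) m n (A : 'M[K]_(m, n)) (B : 'M[K]_(n, m)) :
  \det (1%:M + A *m B) = \det (1%:M + B *m A).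
Proof.
pose L := block_mx (1%:M : 'M[K]_n) 0 A (1%:M : 'M[K]_m).
pose M := block_mx (1%:M : 'M[K]_n) (- B) 0 (1%:M + A *m B).
pose M' := block_mx (1%:M + B *m A) (- B) 0 (1%:M : 'M[K]_m).
(* [L] has determinant 1 and intertwines two block triangular matrices, whose determinants are the
   two sides. *)
have LM : L *m M = M' *m L.
  rewrite !mulmx_block !mul1mx !mul0mx !mulmx0 !mulmx1 !addr0 !add0r.
  by rewrite mulmxN mulNmx addrK addrCA addNr addr0.
have /(congr1 determinant) := LM.
rewrite !det_mulmx /L /M /M' det_lblock !det_ublock !det1 !mul1r !mulr1.
exact.
Qed.

Section SpecialLinear.
Variables (K : fieldType) (W : vectType K).
Implicit Types (g h : 'End(W)) (x u : W) (phi : 'Hom(W, K^o)).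

Let e_basis : basis_of {:W} (vbasis {:W}) := vbasisP _.

Lemma det_end_comp g h : det_end (g \o h)%VF = det_end h * det_end g.
Proof. by rewrite /det_end (passmx.mxof_comp _ _ e_basis) det_mulmx. Qed.

Lemma det_end1 : det_end (\1%VF : 'End(W)) = 1.
Proof. by rewrite /det_end passmx.mxof1 ?(basis_free e_basis) // det1. Qed.

Lemma SL_inverse g : det_end g = 1 ->
  exists2 h, det_end h = 1 & cancel g h /\ cancel h g.
Proof.
move=> g1; set A := passmx.mxof (vbasis {:W}) (vbasis {:W}) g.
have Au : A \in unitmx by rewrite unitmxE /A -/(det_end g) g1 unitr1.
pose h := passmx.hommx (vbasis {:W}) (vbasis {:W}) (invmx A).
have hE : passmx.mxof (vbasis {:W}) (vbasis {:W}) h = invmx A.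
  exact: passmx.hommxK.
have gE : passmx.hommx (vbasis {:W}) (vbasis {:W}) A = g by apply: passmx.mxofK.
exists h; first by rewrite /det_end hE det_inv -/(det_end g) g1 invr1.
have gh : (g \o h)%VF = \1%VF.
  by rewrite -gE -(passmx.hommx_mul e_basis e_basis) // mulVmx // passmx.hommx1.
have hg : (h \o g)%VF = \1%VF.
  by rewrite -gE -(passmx.hommx_mul e_basis e_basis) // mulmxV // passmx.hommx1.
by split=> x; rewrite -comp_lfunE ?hg ?gh lfunE.
Qed.

Definition transvection_fun phi u x := x + form_val phi x *: u.

Fact transvection_fun_linear phi u : linear (transvection_fun phi u).
Proof.
move=> a x y; rewrite /transvection_fun form_valD form_valZ scalerDl scalerDr.
by rewrite scalerA addrACA.
Qed.

HB.instance Definition _ phi u := GRing.isSemilinear.Build K _ _ _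
  (transvection_fun phi u)
  (GRing.semilinear_linear (transvection_fun_linear phi u)).

Definition transvection phi u : 'End(W) := linfun (transvection_fun phi u).

Lemma transvectionE phi u x : transvection phi u x = x + form_val phi x *: u.
Proof. by rewrite lfunE. Qed.

(** The matrix is the identity plus a column times a row. Sylvester's identity reduces its
    determinant to that of a 1 by 1 matrix with entry [1 + phi u]. *)
Lemma det_transvection phi u : form_val phi u = 0 ->
  det_end (transvection phi u) = 1.
Proof.
move=> phiu; rewrite /det_end.
set e := vbasis {:W}.
pose C : 'cV_(\dim {:W}) := \col_j form_val phi e`_j.
have -> : passmx.mxof e e (transvection phi u) = 1%:M + C *m passmx.rVof e u.
  apply/row_matrixP => i; rewrite rowE passmx.mul_mxof passmx.vecof_delta.
  rewrite transvectionE; apply/rowP => j; rewrite !mxE linearD linearZ /=.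
  by rewrite big_ord1 !mxE coord_free ?(basis_free e_basis) // eq_sym.
rewrite det_addmul.
have -> : passmx.rVof e u *m C = 0.
  apply/matrixP => i j; rewrite !mxE -[RHS]phiu.
  rewrite [in RHS](coord_vbasis (memvf u)) form_val_sum.
  by apply: eq_bigr => k _; rewrite !mxE form_valZ.
by rewrite addr0 det1.
Qed.

End SpecialLinear.

Section Multihomogeneous.
Variables (K : fieldType) (W : vectType K) (m : nat) (a : 'I_m -> nat).
Variables (f : 'rV[W]_m -> K) (f_homog : multihomogeneous a f).

Lemma multihomogeneous_scale_all (t : 'I_m -> K) (v : 'rV[W]_m) :
  f (\row_i (t i *: v 0 i)) = (\prod_i t i ^+ a i) * f v.
Proof.
(* Only the arguments listed in [s] are scaled, so that they can be treated one by one. *)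
pose w (s : seq 'I_m) : 'rV[W]_m :=
  \row_i (if i \in s then t i *: v 0 i else v 0 i).
have scale_w (s : seq 'I_m) : uniq s ->
    f (w s) = (\prod_(i <- s) t i ^+ a i) * f v.
  elim: s => [_|i s IHs /= /andP[iNs /IHs ws]].
    by rewrite big_nil mul1r; congr f; apply/rowP => i; rewrite mxE.
  rewrite big_cons -mulrA -ws -f_homog; congr f; apply/rowP => j.
  by rewrite !mxE inE; case: eqP => [->|]; rewrite // (negPf iNs).
rewrite -big_enum -scale_w ?enum_uniq //; congr f; apply/rowP => i.
by rewrite !mxE mem_enum.
Qed.

Lemma multihomogeneous_scale (t : K) (v : 'rV[W]_m) :
  f (map_mx ( *:%R t) v) = t ^+ (\sum_i a i) * f v.
Proof.
rewrite -prodrXr -(multihomogeneous_scale_all (fun=> t)); congr f.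
by apply/rowP => i; rewrite !mxE.
Qed.

End Multihomogeneous.

Lemma map_mx_scale_arg (K : fieldType) (W W' : vectType K) m
    (g : {linear W -> W'}) (i : 'I_m) t (v : 'rV[W]_m) :
  map_mx g (scale_arg i t v) = scale_arg i t (map_mx g v).
Proof. by apply/rowP => j; rewrite !mxE; case: eqP => // _; rewrite linearZ. Qed.

Section ScaleRowMx.
Variables (K : fieldType) (W : vectType K) (n1 n2 : nat).
Implicit Types (v : 'rV[W]_n1) (w : 'rV[W]_n2).

Lemma scale_arg_lshift i t v w :
  scale_arg (lshift n2 i) t (row_mx v w) = row_mx (scale_arg i t v) w.
Proof.
apply/rowP => k; rewrite mxE; case: (split_ordP k) => j ->.
  by rewrite (inj_eq (@lshift_inj _ _)) !row_mxEl mxE.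
by rewrite eq_rlshift !row_mxEr.
Qed.

Lemma scale_arg_rshift i t v w :
  scale_arg (rshift n1 i) t (row_mx v w) = row_mx v (scale_arg i t w).
Proof.
apply/rowP => k; rewrite mxE; case: (split_ordP k) => j ->.
  by rewrite eq_lrshift !row_mxEl.
by rewrite (inj_eq (@rshift_inj _ _)) !row_mxEr mxE.
Qed.

End ScaleRowMx.

(** * Transvection charts on the orbit of a vector *)

Section Chart.
Variables (K : numFieldType) (W : vectType K) (q : W) (psi phi : 'Hom(W, K^o)).
Hypothesis (psiq : form_val psi q = 0) (phiq : form_val phi q = 1).

Definition chart_form x : 'Hom(W, K^o) :=
  form_val psi x *: phi + (1 - form_val phi x) *: psi.

Lemma chart_formE x y : form_val (chart_form x) y =
  form_val psi x * form_val phi y + (1 - form_val phi x) * form_val psi y.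
Proof. by rewrite /form_val add_lfunE !scale_lfunE. Qed.

(* [chart_form x] takes the same value [psi x] at [q] and at [x], so this
   transvection and its inverse exchange them. *)
Definition chart_transvection x (s : K) : 'End(W) :=
  transvection (chart_form x) (s *: (x - q)).

Lemma chart_transvection_det x s : det_end (chart_transvection x s) = 1.
Proof.
apply: det_transvection; rewrite form_valZ chart_formE !form_valB psiq phiq.
by ring.
Qed.

Lemma chart_transvection_src x : form_val psi x != 0 ->
  chart_transvection x (form_val psi x)^-1 q = x.
Proof.
move=> x0; rewrite transvectionE chart_formE psiq phiq mulr0 addr0 mulr1.
by rewrite scalerA divff // scale1r addrC subrK.
Qed.

Lemma chart_transvection_dst x : form_val psi x != 0 ->
  chart_transvection x (- (form_val psi x)^-1) x = q.
Proof.
move=> x0; rewrite transvectionE chart_formE.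
have -> : form_val psi x * form_val phi x + (1 - form_val phi x) * form_val psi x
  = form_val psi x by ring.
by rewrite scalerA mulrN divff // scaleN1r opprB addrC subrK.
Qed.

Variables (n D : nat) (h : 'rV[W]_n -> K).
Hypothesis hP : polynomial_fun h.
Hypothesis h_homog : forall t v, h (map_mx ( *:%R t) v) = t ^+ D * h v.
Hypothesis semi_invariant_stab : forall g : 'End(W), det_end g = 1 -> g q = q ->
  forall v, h (map_mx g v) = h v.

(** For [psi x] nonzero, [h] is evaluated at [psi x] times the image of the first [n] points under
    the transvection that carries [x] back to [q]. The factor clears the only denominator, so the
    function is polynomial everywhere. *)
Definition chart_fun (y : 'rV[W]_(n + 1)) : K :=
  let x := y 0 (rshift n ord0) in
  h (\row_i (form_val psi x *: y 0 (lshift 1 i)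
             - form_val (chart_form x) (y 0 (lshift 1 i)) *: (x - q))).

Lemma polynomial_chart_fun : polynomial_fun chart_fun.
Proof.
apply: (polynomial_fun_comp _ hP) => l i.
have pc := @polynomial_fun_const K W (n + 1).
pose x (y : 'rV[W]_(n + 1)) := y 0 (rshift n ord0).
pose z (y : 'rV[W]_(n + 1)) := y 0 (lshift 1 i).
have px l' : polynomial_fun (fun y => form_val l' (x y)).
  exact: polynomial_fun_form.
have pz l' : polynomial_fun (fun y => form_val l' (z y)).
  exact: polynomial_fun_form.
apply: (@polynomial_fun_ext _ _ _ (fun y =>
  form_val psi (x y) * form_val l (z y)
  - (form_val psi (x y) * form_val phi (z y)
     + (1 - form_val phi (x y)) * form_val psi (z y))
    * (form_val l (x y) - form_val l q))).
  by move=> y; rewrite !mxE !(form_valB, form_valZ) chart_formE.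
apply: polynomial_funB; first by apply: polynomial_funM.
apply: polynomial_funM; last by apply: polynomial_funB.
apply: polynomial_funD; first by apply: polynomial_funM.
by apply: polynomial_funM => //; apply: polynomial_funB.
Qed.

(** The transvection [k] returning [x] to [q] makes [k \o g] an element of the stabilizer of [q],
    which leaves [h] unchanged; the cleared denominator comes out by homogeneity. *)
Lemma chart_fun_orbit (g : 'End(W)) x v :
  det_end g = 1 -> g q = x -> form_val psi x != 0 ->
  chart_fun (row_mx (map_mx g v) (const_mx x)) = form_val psi x ^+ D * h v.
Proof.
move=> g1 gq x0; rewrite /chart_fun row_mxEr mxE.
set k := chart_transvection x (- (form_val psi x)^-1).
rewrite -[in RHS](semi_invariant_stab (g := (k \o g)%VF)); first last.
- by rewrite comp_lfunE gq chart_transvection_dst.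
- by rewrite det_end_comp g1 chart_transvection_det mulr1.
rewrite -h_homog; congr h; apply/rowP => i.
rewrite mxE row_mxEl !mxE comp_lfunE transvectionE.
rewrite [RHS]scalerDr !scalerA.
rewrite -scaleNr; congr (_ + _ *: _).
by field.
Qed.

End Chart.

(** * Extension of a semi-invariant of the stabilizer of a vector *)

Lemma polynomial_map_map_mx (K : fieldType) (W W' : vectType K) m
    (g : {linear W -> W'}) : polynomial_map (fun v : 'rV[W]_m => map_mx g v).
Proof.
move=> l i.
apply: polynomial_fun_ext (polynomial_fun_form (l \o linfun g)%VF i) => v.
by rewrite mxE /form_val comp_lfunE lfunE.
Qed.

Lemma polynomial_map_scale_arg (K : fieldType) (W : vectType K) m (i : 'I_m) t :
  polynomial_map (fun v : 'rV[W]_m => scale_arg i t v).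
Proof.
move=> l j; apply: (@polynomial_fun_ext _ _ _
  (fun v => (if j == i then t else 1) * form_val l (v 0 j))).
  by move=> v; rewrite mxE; case: eqP; rewrite ?form_valZ ?mul1r.
apply: polynomial_funM; first exact: polynomial_fun_const.
exact: polynomial_fun_form.
Qed.

(** Complete [q] to a free pair and take the two coordinate forms. *)
Lemma dual_pair (K : fieldType) (W : vectType K) (q : W) :
  q != 0 -> (1 < \dim {:W})%N ->
  exists e, exists psi phi : 'Hom(W, K^o),
    [/\ form_val psi q = 0, form_val phi q = 1, form_val psi e = 1
      & form_val phi e = 0].
Proof.
move=> q0 dimW.
have [e _ eq] : exists2 e, e \in {:W}%VS & e \notin <[q]>%VS.
  apply/subvPn; apply/negP => /dimvS; rewrite dim_vline q0.
  by rewrite leqNgt dimW.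
pose X := [tuple e; q].
have freeX : free X by rewrite free_cons span_seq1 eq seq1_free.
exists e, (linfun (coord X 0 : W -> K^o)), (linfun (coord X 1 : W -> K^o)).
by split; rewrite /form_val lfunE /= ?(coord_free 0 1 freeX, coord_free 1 1 freeX,
  coord_free 0 0 freeX, coord_free 1 0 freeX).
Qed.

(** A vector space is not the union of two hyperplanes: one of [x], [y], [x + y] works. *)
Lemma forms_common_neq0 (K : fieldType) (W : vectType K) (l l' : 'Hom(W, K^o)) x y :
  form_val l x != 0 -> form_val l' y != 0 ->
  exists z, form_val l z * form_val l' z != 0.
Proof.
move=> lx ly; have [l'x|l'x] := eqVneq (form_val l' x) 0; last first.
  by exists x; rewrite mulf_neq0.
have [l0|l0] := eqVneq (form_val l y) 0; last by exists y; rewrite mulf_neq0.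
by exists (x + y); rewrite !form_valD l'x l0 addr0 add0r mulf_neq0.
Qed.

Lemma row_mx_last (T : Type) n (y : 'rV[T]_(n + 1)) :
  y = row_mx (lsubmx y) (const_mx (y 0 (rshift n ord0))).
Proof.
rewrite -[LHS]hsubmxK; congr row_mx; apply/rowP => i.
by rewrite !mxE !ord1.
Qed.

Section Extension.
Variables (K : numFieldType) (W : vectType K) (q : W) (n : nat).
Variables (a : 'I_n -> nat) (b : nat) (h : 'rV[W]_n -> K).
Hypothesis (q0 : q != 0) (dimW : (1 < \dim {:W})%N).
Hypothesis hP : polynomial_fun h.
Hypothesis h_homog : multihomogeneous a h.
Hypothesis h_semi : forall (g : 'End(W)) u, det_end g = 1 -> u != 0 ->
  g q = u *: q -> forall v, u ^+ b * h (map_mx g v) = h v.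

Lemma semi_invariant_stab (g : 'End(W)) : det_end g = 1 -> g q = q ->
  forall v, h (map_mx g v) = h v.
Proof.
move=> g1 gq v; have := h_semi g1 (oner_neq0 K).
by rewrite scale1r => /(_ gq v); rewrite expr1n mul1r.
Qed.

Let D := (\sum_i a i)%N.
Let pt (v : 'rV[W]_n) (x : W) : 'rV[W]_(n + 1) := row_mx v (const_mx x).
Let tail (y : 'rV[W]_(n + 1)) : W := y 0 (rshift n ord0).

(* [h] extends to the SL-orbit of [q] by [F (g v, g q) = h v]; [psi] and [chi]
   define two charts of this orbit whose union contains [q]. *)
Lemma orbit_extension :
  exists e (psi chi : 'Hom(W, K^o)) F,
    [/\ form_val psi e = 1, form_val chi q != 0, polynomial_fun F,
      (forall x, (form_val psi x != 0) || (form_val chi x != 0) ->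
        exists2 g : 'End(W), det_end g = 1 & g q = x)
    & (forall g : 'End(W), det_end g = 1 ->
        (form_val psi (g q) != 0) || (form_val chi (g q) != 0) ->
        forall v, F (pt (map_mx g v) (g q)) = h v)].
Proof.
have [e [psi [phi [psiq phiq psie phie]]]] := dual_pair q0 dimW.
(* The first chart misses [q], as [psi q = 0]. The second is based at [q + e], where [chi] is 0 and
   [phi] is 1, and it contains [q], as [chi q = -1]. *)
pose chi := psi - phi.
pose S := transvection phi e.
have S1 : det_end S = 1 by apply: det_transvection.
have Sq : S q = q + e by rewrite transvectionE phiq scale1r.
have [S' S'1 [SK S'K]] := SL_inverse S1.
have chiq : form_val chi q = -1 by rewrite form_val_subl psiq phiq sub0r.
have chi_q2 : form_val chi (q + e) = 0.
  by rewrite form_valD chiq form_val_subl psie phie subr0 addNr.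
have phi_q2 : form_val phi (q + e) = 1 by rewrite form_valD phiq phie addr0.
have move_q x : (form_val psi x != 0) || (form_val chi x != 0) ->
    exists2 g : 'End(W), det_end g = 1 & g q = x.
  case/orP => x0.
    exists (chart_transvection q psi phi x (form_val psi x)^-1).
      exact: chart_transvection_det.
    exact: chart_transvection_src.
  exists (chart_transvection (q + e) chi phi x (form_val chi x)^-1 \o S)%VF.
    by rewrite det_end_comp S1 mul1r chart_transvection_det.
  by rewrite comp_lfunE Sq chart_transvection_src.
(* Transport of [h] by [S], which moves [q] to [q + e]: this version is invariant under the
   stabilizer of the new base point. *)
pose h2 (v : 'rV[W]_n) := h (map_mx S' v).
have h2P : polynomial_fun h2.
  exact: (polynomial_fun_comp (polynomial_map_map_mx _) hP).
have h_scale := multihomogeneous_scale h_homog.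
have h2_scale t v : h2 (map_mx ( *:%R t) v) = t ^+ D * h2 v.
  rewrite /h2 -h_scale; congr h; apply/rowP => i.
  by rewrite !mxE linearZ.
have h2_stab (g : 'End(W)) : det_end g = 1 -> g (q + e) = q + e ->
    forall v, h2 (map_mx g v) = h2 v.
  move=> g1 gq v; rewrite /h2 -[RHS](semi_invariant_stab (g := (S' \o g \o S)%VF)).
  - by congr h; apply/rowP => i; rewrite !mxE !comp_lfunE S'K.
  - by rewrite !det_end_comp S1 S'1 g1 !mulr1.
  - by rewrite !comp_lfunE Sq gq -Sq SK.
pose P := chart_fun q psi phi h.
pose P2 := chart_fun (q + e) chi phi h2.
have PP : polynomial_fun P by apply: polynomial_chart_fun.
have P2P : polynomial_fun P2 by apply: polynomial_chart_fun.
have PE (g : 'End(W)) v : det_end g = 1 -> form_val psi (g q) != 0 ->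
    P (pt (map_mx g v) (g q)) = form_val psi (g q) ^+ D * h v.
  by move=> g1; apply: (chart_fun_orbit psiq phiq h_scale semi_invariant_stab).
have P2E (g : 'End(W)) v : det_end g = 1 -> form_val chi (g q) != 0 ->
    P2 (pt (map_mx g v) (g q)) = form_val chi (g q) ^+ D * h v.
  move=> g1 x0.
  have -> : map_mx g v = map_mx (g \o S')%VF (map_mx S v).
    by apply/rowP => i; rewrite !mxE comp_lfunE SK.
  rewrite /P2 (chart_fun_orbit chi_q2 phi_q2 h2_scale h2_stab) //.
  - by congr (_ * h _); apply/rowP => i; rewrite !mxE SK.
  - by rewrite det_end_comp S'1 g1 mulr1.
  - by rewrite comp_lfunE -Sq SK.
have orbit_pt y : (form_val psi (tail y) != 0) || (form_val chi (tail y) != 0) ->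
    exists (g : 'End(W)) v,
      [/\ det_end g = 1, g q = tail y & y = pt (map_mx g v) (g q)].
  move=> /move_q[g g1 gq]; have [g' g'1 [gK g'K]] := SL_inverse g1.
  exists g, (map_mx g' (lsubmx y)); split=> //; rewrite gq.
  rewrite [LHS]row_mx_last; congr row_mx.
  by apply/rowP => i; rewrite !mxE g'K.
have psiP : polynomial_fun (fun y => form_val psi (tail y)).
  exact: polynomial_fun_form.
have chiP : polynomial_fun (fun y => form_val chi (tail y)).
  exact: polynomial_fun_form.
(* On the overlap of the charts both sides equal [(psi chi)^D h]; the overlap is dense, being
   nonempty at [e]. *)
have glue y : form_val chi (tail y) ^+ D * P y = form_val psi (tail y) ^+ D * P2 y.
  move: y; apply: (polynomial_fun_dense (polynomial_funM psiP chiP)).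
  - by apply: polynomial_funM => //; apply: polynomial_funX.
  - by apply: polynomial_funM => //; apply: polynomial_funX.
  - exists (const_mx e); rewrite /tail mxE form_val_subl psie phie subr0 mulr1.
    exact: oner_neq0.
  move=> y; rewrite mulf_eq0 negb_or => /andP[y1 y2].
  have [|g [v [g1 gq ->]]] := orbit_pt y; first by rewrite y1.
  have tE w x : tail (pt w x) = x by rewrite /tail row_mxEr mxE.
  by rewrite tE PE ?P2E ?gq // mulrCA.
have chie : form_val chi q != 0 by rewrite chiq oppr_eq0 oner_neq0.
(* Here [q] is the witness of coprimality, as [psi q = 0] and [chi q != 0]; [F] is the quotient of
   [P] by [psi^D]. *)
have [F FP FE] := form_exp_dvd psie psiq chie PP P2P glue.
have F2E y : P2 y = form_val chi (tail y) ^+ D * F y.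
  move: y; apply: (polynomial_fun_dense (polynomial_funX D psiP)) => //.
  - by apply: polynomial_funM => //; apply: polynomial_funX.
  - exists (const_mx e); rewrite /tail mxE psie expr1n; exact: oner_neq0.
  by move=> y y0; apply: (mulfI y0); rewrite -glue FE mulrCA.
exists e, psi, chi, F; split=> // g g1 x0 v.
have tE w x : tail (pt w x) = x by rewrite /tail row_mxEr mxE.
case/orP: x0 => x0; apply: (mulfI (expf_neq0 D x0)).
  by rewrite -PE // FE -/(tail _) tE.
by rewrite -P2E // F2E tE.
Qed.

(** Each property of [F] is checked on points [(g v, g q)], where [F] is given by [h], and spreads
    by density of the locus where [psi] is nonzero on the last point. *)
Lemma invariant_extension (a' : 'I_(n + 1) -> nat) :
  (forall i, a' (lshift 1 i) = a i) -> a' (rshift n ord0) = b ->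
  exists2 F, multidegree_invariant a' F & forall v, F (pt v q) = h v.
Proof.
move=> a'l a'r.
have [e [psi [chi [F [psie chiq FP move_q FE]]]]] := orbit_extension.
have tE w x : tail (pt w x) = x by rewrite /tail row_mxEr mxE.
have psiP : polynomial_fun (fun y => form_val psi (tail y)).
  exact: polynomial_fun_form.
have psi_neq0 : exists y, form_val psi (tail y) != 0.
  by exists (const_mx e); rewrite /tail mxE psie oner_neq0.
have orbit_pt y : form_val psi (tail y) != 0 ->
    exists (g : 'End(W)) v,
      [/\ det_end g = 1, form_val psi (g q) != 0 & y = pt (map_mx g v) (g q)].
  move=> y0; have [|g g1 gq] := move_q (tail y); first by rewrite y0.
  have [g' g'1 [gK g'K]] := SL_inverse g1.
  exists g, (map_mx g' (lsubmx y)); rewrite gq; split=> //.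
  rewrite [LHS]row_mx_last; congr row_mx.
  by apply/rowP => i; rewrite !mxE g'K.
exists F; last first.
  move=> v; have := FE \1%VF (det_end1 _); rewrite lfunE /= chiq orbT.
  move=> /(_ isT v) <-; congr (F (pt _ _)).
  by apply/rowP => i; rewrite mxE lfunE.
split=> // [i t|g g1].
- case: (split_ordP i) => j -> {i}.
    apply: (polynomial_fun_dense psiP) => //.
    + exact: (polynomial_fun_comp (polynomial_map_scale_arg _ _) FP).
    + by apply: polynomial_funM => //; apply: polynomial_fun_const.
    move=> y /orbit_pt[g [v [g1 x0 ->]]].
    have -> : scale_arg (lshift 1 j) t (pt (map_mx g v) (g q))
            = pt (map_mx g (scale_arg j t v)) (g q).
      by rewrite scale_arg_lshift map_mx_scale_arg.
    by rewrite !FE ?x0 // h_homog a'l.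
  rewrite (ord1 j) a'r {j}.
  have scaleE s v x : scale_arg (rshift n ord0) s (pt v x) = pt v (s *: x).
    rewrite scale_arg_rshift; congr row_mx; apply/rowP => k.
    by rewrite !mxE !ord1 eqxx.
  (* Some [k] of determinant 1 maps [q] to [s *: q], because [chi] is nonzero there. Replacing [g]
     by [g \o k] turns scaling of the last point into the semi-invariance of [h] under [k]. *)
  have homog_neq0 s : s != 0 -> forall y,
      F (scale_arg (rshift n ord0) s y) = s ^+ b * F y.
    move=> s0; apply: (polynomial_fun_dense psiP) => //.
    + exact: (polynomial_fun_comp (polynomial_map_scale_arg _ _) FP).
    + by apply: polynomial_funM => //; apply: polynomial_fun_const.
    move=> y /orbit_pt[g [v [g1 x0 ->]]]; rewrite scaleE.
    have [|k k1 kq] := move_q (s *: q).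
      by rewrite !form_valZ (mulf_neq0 s0 chiq) orbT.
    have [k' k'1 [kK k'K]] := SL_inverse k1.
    have -> : pt (map_mx g v) (s *: g q)
            = pt (map_mx (g \o k)%VF (map_mx k' v)) ((g \o k)%VF q).
      rewrite comp_lfunE kq linearZ; congr (pt _ _).
      by apply/rowP => i; rewrite !mxE comp_lfunE k'K.
    rewrite !FE ?x0 //; first last.
    + by rewrite comp_lfunE kq linearZ /= form_valZ mulf_neq0.
    + by rewrite det_end_comp k1 g1 mulr1.
    rewrite -(h_semi k1 s0 kq); congr (_ * h _).
    by apply/rowP => i; rewrite !mxE k'K.
  move=> y.
  (* To include the scalar 0, view the value as a polynomial in the scalar: it agrees with the
     monomial [F y *: 'X^b] off 0, hence everywhere. *)
  have [p pE] := polynomial_fun_line (pt (lsubmx y) 0) (pt 0 (tail y)) FP.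
  have lineE s : pt (lsubmx y) 0 + map_mx ( *:%R s) (pt 0 (tail y))
      = scale_arg (rshift n ord0) s y.
    rewrite [in RHS](row_mx_last y) scaleE /pt map_row_mx add_row_mx.
    by congr row_mx; apply/rowP => i; rewrite !mxE ?scaler0 ?addr0 ?add0r.
  have : p - F y *: 'X^b = 0.
    apply: poly_eq0_off0 => s s0.
    by rewrite hornerD hornerN hornerZ hornerXn -pE lineE homog_neq0 // mulrC subrr.
  move=> /(congr1 (horner^~ t)); rewrite hornerD hornerN hornerZ hornerXn horner0.
  by rewrite -pE lineE => /eqP; rewrite subr_eq0 mulrC => /eqP.
- have [g' g'1 [gK g'K]] := SL_inverse g1.
  have psigP : polynomial_fun (fun y => form_val (psi \o g)%VF (tail y)).
    exact: polynomial_fun_form.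
  (* The last point must lie in the [psi] chart both before and after applying [g]. *)
  apply: (polynomial_fun_dense (polynomial_funM psiP psigP)) => //.
  + exact: (polynomial_fun_comp (polynomial_map_map_mx _) FP).
  + have [||z z0] := @forms_common_neq0 _ _ psi (psi \o g)%VF e (g' e).
    * by rewrite psie oner_neq0.
    * by rewrite form_val_comp g'K psie oner_neq0.
    by exists (const_mx z); rewrite /tail mxE.
  move=> y; rewrite mulf_eq0 negb_or => /andP[/orbit_pt[k [v [k1 x0 ->]]]].
  rewrite tE form_val_comp => x1.
  have -> : map_mx g (pt (map_mx k v) (k q))
          = pt (map_mx (g \o k)%VF v) ((g \o k)%VF q).
    rewrite /pt map_row_mx; congr row_mx;
      by apply/rowP => i; rewrite !mxE comp_lfunE.
  by rewrite !FE ?x0 // ?comp_lfunE ?x1 // det_end_comp k1 g1 mulr1.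
Qed.

End Extension.

(** * Kernels of finite rank and gluing of endomorphisms *)

Lemma det_block_schur (K : comUnitRingType) m n (A : 'M[K]_m) (B : 'M[K]_(m, n))
    (C : 'M[K]_(n, m)) (D : 'M[K]_n) : A \in unitmx ->
  \det (block_mx A B C D) = \det A * \det (D - C *m invmx A *m B).
Proof.
move=> Au.
have -> : block_mx A B C D = block_mx 1%:M 0 (C *m invmx A) 1%:M
                          *m block_mx A B 0 (D - C *m invmx A *m B).
  rewrite mulmx_block !mul1mx !mul0mx !addr0 mulmxKV //.
  by rewrite addrC subrK.
by rewrite det_mulmx det_lblock det_ublock !det1 !mul1r.
Qed.

Section SkeletonDecomposition.
Variables (K : fieldType) (X Y : Type) (H : X -> Y -> K).

Definition sample_mx n (xs : 'I_n -> X) (ys : 'I_n -> Y) : 'M[K]_n :=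
  \matrix_(i, j) H (xs i) (ys j).

Definition has_minor n := exists xs ys, @sample_mx n xs ys \in unitmx.

Lemma has_minor_bound n r (A : X -> 'rV[K]_r) (B : Y -> 'cV[K]_r) :
  (forall x y, H x y = (A x *m B y) 0 0) -> has_minor n -> (n <= r)%N.
Proof.
move=> HE [xs [ys M_unit]]; rewrite -(mxrank_unit M_unit).
have -> : sample_mx xs ys
    = (\matrix_(i, k) A (xs i) 0 k) *m (\matrix_(k, j) B (ys j) k 0).
  apply/matrixP => i j; rewrite !mxE HE mxE.
  by apply: eq_bigr => k _; rewrite !mxE.
exact: mulmx_max_rank.
Qed.

(* A kernel of finite rank is spanned by finitely many of its own sections:
   take a maximal invertible minor; all bordered minors vanish. *)
Lemma skeleton_decomposition r (A : X -> 'rV[K]_r) (B : Y -> 'cV[K]_r) :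
  (forall x y, H x y = (A x *m B y) 0 0) ->
  exists n (xs : 'I_n -> X) (ys : 'I_n -> Y) (C : 'M[K]_n), forall x y,
    H x y = \sum_i H x (ys i) * \sum_j C i j * H (xs j) y.
Proof.
move=> HE.
(* Otherwise, starting from the empty minor, of determinant 1, there would be invertible minors of
   every size, against the bound [r]. *)
have [n [[xs [ys Mu]] nmax]] : exists n, has_minor n /\ ~ has_minor (n + 1).
  apply: contrapT => noex.
  have step n : has_minor n -> has_minor n.+1.
    move=> mn; apply: contrapT => nmn; apply: noex; exists n.
    by rewrite addn1.
  have all_minors n : has_minor n.
    elim: n => [|n]; last exact: step.
    have no0 (T : Type) (i : 'I_0) : T by case: i.
    by exists (no0 X), (no0 Y); rewrite unitmxE det_mx00 unitr1.
  by have := has_minor_bound HE (all_minors r.+1); rewrite ltnn.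
exists n, xs, ys, (invmx (sample_mx xs ys)) => x y.
set M := sample_mx xs ys in Mu *.
pose b : 'cV[K]_n := \col_i H (xs i) y.
pose c : 'rV[K]_n := \row_j H x (ys j).
pose d : 'M[K]_1 := (H x y)%:M.
(* Up to the factor [\det M], this Schur complement is the minor bordered by [x] and [y], which
   vanishes by maximality. *)
have : d - c *m invmx M *m b = 0.
  rewrite [LHS]mx11_scalar -det_mx11.
  have Mdet0 : \det M != 0 by move: Mu; rewrite unitmxE unitfE.
  suff -> : \det (d - c *m invmx M *m b) = 0 by apply/matrixP => i j; rewrite !mxE mul0rn.
  apply: (mulfI Mdet0); rewrite -det_block_schur // mulr0.
  apply/eqP; apply: contrapT => /negP nz; apply: nmax.
  exists (fun i => if split i is inl j then xs j else x).
  exists (fun i => if split i is inl j then ys j else y).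
  rewrite unitmxE unitfE; move: nz; congr (\det _ != 0).
  apply/matrixP => i j; rewrite !mxE.
  case: (split i) => i'; rewrite !mxE; case: (split j) => j'; rewrite !mxE //.
  by rewrite !ord1 eqxx mulr1n.
move=> /eqP; rewrite subr_eq0 => /eqP/matrixP/(_ 0 0).
rewrite mxE eqxx mulr1n => ->; rewrite -mulmxA mxE.
by apply: eq_bigr => i _; rewrite !mxE; congr (_ * _);
  apply: eq_bigr => j _; rewrite !mxE.
Qed.

End SkeletonDecomposition.

(** A linear form in one argument depends on one block only; sums concatenate the lists of terms and
    products multiply them over all pairs. *)
Lemma polynomial_fun_finite_rank (K : fieldType) (W : vectType K) n1 n2
    (f : 'rV[W]_(n1 + n2) -> K) : polynomial_fun f ->
  exists s : seq (('rV[W]_n1 -> K) * ('rV[W]_n2 -> K)), forall v w,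
    f (row_mx v w) = \sum_(p <- s) p.1 v * p.2 w.
Proof.
elim/polynomial_fun_ind: f / => [f g fg [s sE]|a|i l|f g _ _ [s sE] [t tE]
  |f g _ _ [s sE] [t tE]].
- by exists s => v w; rewrite -fg.
- by exists [:: (fun=> a, fun=> 1)] => v w; rewrite big_seq1 mulr1.
- case: (split_ordP i) => j ->.
    exists [:: (fun v : 'rV[W]_n1 => form_val l (v 0 j), fun=> 1)] => v w.
    by rewrite big_seq1 row_mxEl mulr1.
  exists [:: (fun=> 1, fun w : 'rV[W]_n2 => form_val l (w 0 j))] => v w.
  by rewrite big_seq1 row_mxEr mul1r.
- by exists (s ++ t) => v w; rewrite big_cat sE tE.
- exists [seq (fun v => p.1 v * p'.1 v, fun w => p.2 w * p'.2 w) | p <- s, p' <- t].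
  move=> v w; rewrite big_allpairs_dep sE tE mulr_suml; apply: eq_bigr => p _.
  by rewrite mulr_sumr; apply: eq_bigr => p' _ /=; rewrite mulrACA.
Qed.

(** * Determinants on direct sums *)

Section DirectSum.
Variables (K : fieldType) (V : vectType K).

Lemma dim_subvs (U : {vspace V}) : \dim {:subvs_of U} = \dim U.
Proof. by rewrite dimvf. Qed.

Lemma det_end_scale (a : K) (g : 'End(V)) :
  det_end (a *: g) = a ^+ \dim {:V} * det_end g.
Proof.
rewrite /det_end -detZ; congr (\det _); apply/matrixP => i j.
by rewrite !mxE /= scale_lfunE linearZ.
Qed.

(** Base change for square matrices whose sizes are only provably equal, such as [\dim U1 + \dim U2]
    and [\dim {:V}]. *)
Lemma det_intertwine m n (A : 'M[K]_m) (M : 'M[K]_n) (E : 'M[K]_(m, n)) :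
  m = n -> row_free E -> E *m M = A *m E -> \det M = \det A.
Proof.
move=> mn; subst n; rewrite row_free_unit => Eu /(congr1 determinant).
rewrite !det_mulmx mulrC => /(mulIf _); apply.
by move: Eu; rewrite unitmxE unitfE.
Qed.

Lemma det_end_direct_sum (U1 U2 : {vspace V}) (g : 'End(V))
    (g1 : 'End(subvs_of U1)) (g2 : 'End(subvs_of U2)) :
  (U1 :&: U2 = 0)%VS -> (U1 + U2 = {:V})%VS ->
  (forall x, g (vsval x) = vsval (g1 x)) ->
  (forall x, g (vsval x) = vsval (g2 x)) ->
  det_end g = det_end g1 * det_end g2.
Proof.
move=> U0 UV gg1 gg2.
pose i1 : 'Hom(subvs_of U1, V) := linfun vsval.
pose i2 : 'Hom(subvs_of U2, V) := linfun vsval.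
set e := vbasis {:V}.
pose E1 := passmx.mxof (vbasis {:subvs_of U1}) e i1.
pose E2 := passmx.mxof (vbasis {:subvs_of U2}) e i2.
pose G1 := passmx.mxof (vbasis {:subvs_of U1}) (vbasis {:subvs_of U1}) g1.
pose G2 := passmx.mxof (vbasis {:subvs_of U2}) (vbasis {:subvs_of U2}) g2.
have eB : basis_of {:V} e := vbasisP _.
have e1B := vbasisP {:subvs_of U1}; have e2B := vbasisP {:subvs_of U2}.
rewrite -[RHS](det_ublock G1 0 G2); apply: (det_intertwine (E := col_mx E1 E2)).
- by rewrite !dim_subvs -(dimv_disjoint_sum U0) UV.
- apply: inj_row_free => u; rewrite -[u]hsubmxK mul_row_col.
  rewrite !passmx.mul_mxof !lfunE /= => u0.
  set x := passmx.vecof _ _ in u0; set y := passmx.vecof _ _ in u0.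
  have xy0 : vsval x + vsval y = 0.
    apply/eqP; rewrite -(passmx.rVof_eq0 eB) -u0; apply/eqP.
    by apply/rowP => i; rewrite !mxE linearD.
  have : vsval x \in (U1 :&: U2)%VS.
    rewrite memv_cap subvsP -(addrK (vsval y) (vsval x)) xy0 sub0r.
    by rewrite memvN subvsP.
  rewrite U0 memv0 => /eqP x0.
  have y0 : vsval y = 0 by move: xy0; rewrite x0 add0r.
  have /eqP : x = 0 by apply: subvs_inj; rewrite x0 linear0.
  rewrite passmx.vecof_eq0 // => /eqP ->.
  have /eqP : y = 0 by apply: subvs_inj; rewrite y0 linear0.
  by rewrite passmx.vecof_eq0 // => /eqP ->; rewrite row_mx0.
rewrite mul_col_mx mul_block_col !mul0mx addr0 add0r.
rewrite -!(passmx.mxof_comp _ _ eB) -(passmx.mxof_comp _ _ e1B).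
rewrite -(passmx.mxof_comp _ _ e2B); congr (col_mx (passmx.mxof _ _ _)
  (passmx.mxof _ _ _)); by apply/lfunP => x; rewrite !comp_lfunE !lfunE /=.
Qed.

End DirectSum.

Section Gluing.
Variables (K : fieldType) (V : vectType K) (V1 V2 : {vspace V}) (q : V).
Hypothesis (hadd : (V1 + V2)%VS = {:V}%VS) (hcap : (V1 :&: V2)%VS = <[q]>%VS).

(** The map [s *: g1] on [V1] and the homothety of ratio [s * u] on [V2] agree on the line of [q].
    The determinant is computed on [V1] and a complement [C] of [V1] chosen inside [V2]. *)
Lemma glue_end (g1 : 'End(subvs_of V1)) (u s : K) :
  g1 (vsproj V1 q) = u *: vsproj V1 q ->
  exists g : 'End(V),
    [/\ det_end g = s ^+ \dim {:V} * u ^+ (\dim {:V} - \dim V1) * det_end g1,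
      forall x, g (vsval x) = s *: vsval (g1 x)
    & forall y, y \in V2 -> g y = (s * u) *: y].
Proof.
move=> g1q; pose C := (V2 :\: V1)%VS.
have C0 : (V1 :&: C = 0)%VS by rewrite capvC capv_diff.
have CV : (V1 + C = {:V})%VS by rewrite addvC addv_diff addvC.
have dimV : \dim {:V} = (\dim V1 + \dim C)%N.
  by rewrite -CV dimv_disjoint_sum.
pose g : 'End(V) := s *: (linfun vsval \o g1 \o linfun (vsproj V1)
   \o daddv_pi V1 C)%VF + (s * u) *: daddv_pi C V1.
have gE x : g x = s *: vsval (g1 (vsproj V1 (daddv_pi V1 C x)))
                + (s * u) *: daddv_pi C V1 x.
  by rewrite /g add_lfunE !scale_lfunE !comp_lfunE !lfunE.
clearbody g.
have g_V1 x : g (vsval x) = s *: vsval (g1 x).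
  rewrite gE daddv_pi_id ?subvsP // vsvalK.
  have -> : daddv_pi C V1 (vsval x) = 0.
    apply: (addrI (vsval x)); rewrite addr0 -[X in X + _](daddv_pi_id C0 (subvsP x)).
    by rewrite daddv_pi_add // CV memvf.
  by rewrite scaler0 addr0.
have g_C y : y \in C -> g y = (s * u) *: y.
  move=> yC; rewrite gE (@daddv_pi_id _ _ C V1) 1?capvC //.
  have -> : daddv_pi V1 C y = 0.
    have C0' : (C :&: V1 = 0)%VS by rewrite capvC.
    apply: (addIr y); rewrite add0r -[X in _ + X](daddv_pi_id C0' yC).
    by rewrite daddv_pi_add // CV memvf.
  by rewrite !linear0 add0r.
have qV1 : q \in V1.
  by have /memv_capP[] : q \in (V1 :&: V2)%VS by rewrite hcap memv_line.
exists g; split=> //.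
  rewrite (@det_end_direct_sum _ _ V1 C g (s *: g1) ((s * u) *: \1%VF)) //.
  - rewrite !det_end_scale det_end1 !dim_subvs dimV addKn.
    by rewrite exprMn exprD; ring.
  - by move=> x; rewrite g_V1 scale_lfunE linearZ.
  - by move=> x; rewrite g_C ?subvsP // scale_lfunE lfunE linearZ.
(* An element of [V2] is the sum of an element of [C] and a multiple of [q], both scaled by
   [s * u]. *)
move=> y; rewrite -(addv_diff_cap V2 V1) -/C => /memv_addP[c cC [z]].
rewrite capvC hcap => /vlineP[t ->] ->.
rewrite linearD /= g_C // [X in _ + X]linearZ /= -[q in LHS](vsprojK qV1) g_V1 g1q.
by rewrite linearZ /= vsprojK // scalerDr !scalerA; congr (_ + _ *: _); ring.
Qed.

End Gluing.

(** * Semi-invariance of restricted invariants *)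

Section Restriction.
Variables (K : numClosedFieldType) (V : vectType K) (V1 V2 : {vspace V}) (q : V).
Hypothesis (hadd : (V1 + V2)%VS = {:V}%VS) (hcap : (V1 :&: V2)%VS = <[q]>%VS).
Variables (m k b : nat) (a : 'I_m -> nat) (f : 'rV[V]_m -> K) (S : pred 'I_m).
Hypothesis f_inv : multidegree_invariant a f.
Hypothesis a_sum : (\sum_i a i = k * \dim {:V})%N.
Hypothesis a_sumC : (\sum_(i | ~~ S i) a i = k * (\dim {:V} - \dim V1) + b)%N.

Lemma restriction_semi_invariant (g1 : 'End(subvs_of V1)) (u : K) (y : 'rV[V]_m) :
  det_end g1 = 1 -> u != 0 -> g1 (vsproj V1 q) = u *: vsproj V1 q ->
  (0 < \dim {:V})%N ->
  (forall i, if S i then y 0 i \in V1 else y 0 i \in V2) ->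
  u ^+ b * f (\row_i (if S i then vsval (g1 (vsproj V1 (y 0 i))) else y 0 i)) = f y.
Proof.
move=> g1_det u0 g1q dimV yV.
have := a_sumC; set d := (\dim {:V} - \dim V1)%N => a_sumC'.
(* This root, available over an algebraically closed field, gives the glued endomorphism determinant
   1. *)
pose s := (\dim {:V}).-root (u ^- d).
have sE : s ^+ \dim {:V} = u ^- d by apply: rootCK.
have [g [g_det gV1 gV2]] := glue_end hadd hcap s g1q.
have [_ f_homog f_SL] := f_inv.
rewrite -[RHS](f_SL g); last first.
  by rewrite g_det g1_det -/d sE mulr1 mulVf // expf_neq0.
set y' := \row_i _.
have -> : map_mx g y = \row_i ((s * if S i then 1 else u) *: y' 0 i).
  apply/rowP => i; rewrite !mxE; move: (yV i); case: (S i) => yi.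
    by rewrite -[y 0 i in LHS](vsprojK yi) gV1 mulr1.
  by rewrite gV2.
(* The scalars contribute [s^(k dim V) u^(k d + b)], which is [u^b] since [s^(dim V) = u^(-d)]. *)
rewrite (multihomogeneous_scale_all f_homog); congr (_ * _).
under eq_bigr => i _ do rewrite exprMn.
rewrite big_split /= prodrXr a_sum mulnC exprM sE.
have -> : \prod_i (if S i then 1 else u) ^+ a i = u ^+ (k * d + b).
  rewrite -a_sumC' -prodrXr [RHS]big_mkcond; apply: eq_bigr => i _.
  by case: (S i); rewrite ?expr1n.
by rewrite exprD mulrA mulnC exprM -exprMn mulVf ?expf_neq0 // expr1n mul1r.
Qed.

End Restriction.

(** * Restriction to a pair of subspaces *)

Lemma polynomial_map_const (K : fieldType) (W W' : vectType K) m m'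
    (w : 'rV[W']_m') : polynomial_map (fun _ : 'rV[W]_m => w).
Proof. by move=> l i; apply: polynomial_fun_const. Qed.

Lemma polynomial_map_row_mx (K : fieldType) (W W' : vectType K) m m1 m2
    (phi1 : 'rV[W]_m -> 'rV[W']_m1) (phi2 : 'rV[W]_m -> 'rV[W']_m2) :
  polynomial_map phi1 -> polynomial_map phi2 ->
  polynomial_map (fun v => row_mx (phi1 v) (phi2 v)).
Proof.
move=> phi1P phi2P l i; case: (split_ordP i) => j ->.
  by apply: polynomial_fun_ext (phi1P l j) => v; rewrite row_mxEl.
by apply: polynomial_fun_ext (phi2P l j) => v; rewrite row_mxEr.
Qed.

Lemma vsproj_neq0 (K : fieldType) (V : vectType K) (U : {vspace V}) (q : V) :
  q \in U -> q != 0 -> vsproj U q != 0.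
Proof.
by move=> qU; apply: contraNneq => q0; rewrite -(vsprojK qU) q0 linear0.
Qed.

Section AttachDecomposition.
Variables (K : numClosedFieldType) (V : vectType K) (V1 V2 : {vspace V}) (q : V).
Variables (n1 n2 k b1 b2 : nat).
Variables (a : 'I_(n1 + n2) -> nat) (a1 : 'I_(n1 + 1) -> nat) (a2 : 'I_(n2 + 1) -> nat).
Variable f : 'rV[V]_(n1 + n2) -> K.
Hypothesis (hadd : (V1 + V2)%VS = {:V}%VS) (hcap : (V1 :&: V2)%VS = <[q]>%VS).
Hypothesis (q0 : q != 0) (dimV1 : (1 < \dim V1)%N) (dimV2 : (1 < \dim V2)%N).
Hypothesis f_inv : multidegree_invariant a f.
Hypothesis a_sum : (\sum_i a i = k * \dim {:V})%N.
Hypothesis a_suml :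
  (\sum_i a (lshift n2 i) = k * (\dim {:V} - \dim V2) + b2)%N.
Hypothesis a_sumr :
  (\sum_i a (rshift n1 i) = k * (\dim {:V} - \dim V1) + b1)%N.
Hypothesis (a1l : forall i, a1 (lshift 1 i) = a (lshift n2 i))
           (a1r : a1 (rshift n1 ord0) = b1).
Hypothesis (a2l : forall i, a2 (lshift 1 i) = a (rshift n1 i))
           (a2r : a2 (rshift n2 ord0) = b2).

Let pt (v : 'rV[subvs_of V1]_n1) (w : 'rV[subvs_of V2]_n2) : 'rV[V]_(n1 + n2) :=
  row_mx (map_mx vsval v) (map_mx vsval w).
Let H v w := f (pt v w).

Let dimV : (0 < \dim {:V})%N.
Proof. by rewrite (leq_trans _ (dimvS (subvf V1))) // ltnW. Qed.

Lemma restriction_left_semi w (g : 'End(subvs_of V1)) u : det_end g = 1 -> u != 0 ->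
  g (vsproj V1 q) = u *: vsproj V1 q ->
  forall v, u ^+ b1 * H (map_mx g v) w = H v w.
Proof.
move=> g1 u0 gq v.
have sumC : (\sum_(i < n1 + n2 | ~~ (i < n1)%N) a i
             = k * (\dim {:V} - \dim V1) + b1)%N.
  rewrite -a_sumr big_split_ord big_pred0 ?add0n => [|i]; last first.
    by rewrite /= ltn_ord.
  by apply: eq_bigl => i; rewrite /= ltnNge leq_addr.
rewrite -[RHS](restriction_semi_invariant hadd hcap
  (S := fun i : 'I_(n1 + n2) => (i < n1)%N) f_inv a_sum sumC g1 u0 gq dimV).
  congr (_ * f _); apply/rowP => i; rewrite [RHS]mxE.
  case: (split_ordP i) => j -> /=.
    by rewrite /pt !row_mxEl !mxE vsvalK.
  by rewrite /pt !row_mxEr.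
move=> i; case: (split_ordP i) => j -> /=.
  by rewrite /pt !row_mxEl mxE subvsP.
by rewrite /pt !row_mxEr mxE subvsP.
Qed.

Lemma restriction_right_semi v (g : 'End(subvs_of V2)) u : det_end g = 1 -> u != 0 ->
  g (vsproj V2 q) = u *: vsproj V2 q ->
  forall w, u ^+ b2 * H v (map_mx g w) = H v w.
Proof.
move=> g1 u0 gq w.
have sumC : (\sum_(i < n1 + n2 | ~~ (n1 <= i)%N) a i
             = k * (\dim {:V} - \dim V2) + b2)%N.
  rewrite -a_suml big_split_ord -[RHS]addn0; congr (_ + _)%N.
    by apply: eq_bigl => i; rewrite /= -ltnNge ltn_ord.
  by rewrite big_pred0 // => i; rewrite /= leq_addr.
have hadd' : (V2 + V1)%VS = {:V}%VS by rewrite addvC.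
have hcap' : (V2 :&: V1)%VS = <[q]>%VS by rewrite capvC.
rewrite -[RHS](restriction_semi_invariant hadd' hcap'
  (S := fun i : 'I_(n1 + n2) => (n1 <= i)%N) f_inv a_sum sumC g1 u0 gq dimV).
  congr (_ * f _); apply/rowP => i; rewrite [RHS]mxE.
  case: (split_ordP i) => j -> /=.
    by rewrite (leqNgt n1) ltn_ord /pt !row_mxEl.
  by rewrite leq_addr /pt !row_mxEr !mxE vsvalK.
move=> i; case: (split_ordP i) => j -> /=.
  by rewrite (leqNgt n1) ltn_ord /pt !row_mxEl mxE subvsP.
by rewrite leq_addr /pt !row_mxEr mxE subvsP.
Qed.

Lemma attach_decomposition :
  exists F : 'rV[subvs_of V1]_(n1 + 1) -> 'rV[subvs_of V2]_(n2 + 1) -> K,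
    in_tensor (multidegree_invariant a1) (multidegree_invariant a2) F /\
    forall v w, H v w =
      F (row_mx v (const_mx (vsproj V1 q))) (row_mx w (const_mx (vsproj V2 q))).
Proof.
have [fP f_homog _] := f_inv.
have /andP[qV1 qV2] : (q \in V1) && (q \in V2).
  by rewrite -memv_cap hcap memv_line.
have [s sE] := polynomial_fun_finite_rank fP.
have [r [xs [ys [C HE]]]] : exists r (xs : 'I_r -> 'rV[subvs_of V1]_n1)
    (ys : 'I_r -> 'rV[subvs_of V2]_n2) (C : 'M[K]_r), forall v w,
    H v w = \sum_i H v (ys i) * \sum_j C i j * H (xs j) w.
  apply: (@skeleton_decomposition K _ _ H (size s)
    (fun v => \row_i (tnth (in_tuple s) i).1 (map_mx vsval v))
    (fun w => \col_i (tnth (in_tuple s) i).2 (map_mx vsval w))) => v w.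
  rewrite /H sE big_tnth mxE.
  by apply: eq_bigr => i _; rewrite !mxE.
have HlP w : polynomial_fun (H^~ w).
  apply: (polynomial_fun_comp (phi := pt^~ w) _ fP).
  apply: polynomial_map_row_mx; first exact: polynomial_map_map_mx.
  exact: polynomial_map_const.
have HrP v : polynomial_fun (H v).
  apply: (polynomial_fun_comp (phi := pt v) _ fP).
  apply: polynomial_map_row_mx; first exact: polynomial_map_const.
  exact: polynomial_map_map_mx.
have Hl_homog w : multihomogeneous (fun i => a (lshift n2 i)) (H^~ w).
  move=> i t v; rewrite -f_homog scale_arg_lshift.
  by rewrite /H /pt map_mx_scale_arg.
have Hr_homog v : multihomogeneous (fun i => a (rshift n1 i)) (H v).
  move=> i t w; rewrite -f_homog scale_arg_rshift.
  by rewrite /H /pt map_mx_scale_arg.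
have /fin_all_exists2[F1 F1inv F1E] (i : 'I_r) :
    exists2 F, multidegree_invariant a1 F &
      forall v, F (row_mx v (const_mx (vsproj V1 q))) = H v (ys i).
  apply: invariant_extension a1l a1r => //.
  - exact: vsproj_neq0.
  - by rewrite dim_subvs.
  - exact: restriction_left_semi.
(* Polynomiality, homogeneity and semi-invariance are linear conditions, so they pass from the
   sections [H (xs j)] to their combinations. *)
have /fin_all_exists2[F2 F2inv F2E] (i : 'I_r) :
    exists2 F, multidegree_invariant a2 F &
      forall w, F (row_mx w (const_mx (vsproj V2 q)))
                = \sum_j C i j * H (xs j) w.
  apply: invariant_extension a2l a2r.
  - exact: vsproj_neq0.
  - by rewrite dim_subvs.
  - apply: polynomial_fun_sum => j; apply: polynomial_funM => //.
    exact: polynomial_fun_const.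
  - move=> l t w; rewrite mulr_sumr; apply: eq_bigr => j _.
    by rewrite Hr_homog mulrCA.
  - move=> g u g1 u0 gq w; rewrite mulr_sumr; apply: eq_bigr => j _.
    by rewrite mulrCA restriction_right_semi.
exists (fun x y => \sum_i F1 i x * F2 i y); split; first by exists r, F1, F2.
by move=> v w; rewrite HE; apply: eq_bigr => i _; rewrite F1E F2E.
Qed.

End AttachDecomposition.

Theorem theorem1p1 (R : realType) (n1 n2 d1 d2 : nat)
  (hn1 : (2 <= n1)%N) (hn2 : (2 <= n2)%N)
  (hd1 : (1 <= d1)%N) (hd2 : (1 <= d2)%N)
  (V : vectType R[i]) (hV : \dim {:V} = (d1 + d2 + 1)%N)
  (V1 V2 : {vspace V})
  (hV1 : \dim V1 = (d1 + 1)%N) (hV2 : \dim V2 = (d2 + 1)%N)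
  (hadd : (V1 + V2)%VS = {:V}%VS)
  (q : V) (hq : q != 0) (hcap : (V1 :&: V2)%VS = <[q]>%VS)
  (c : 'rV[rat]_(n1 + n2))
  (hc : hypersimplex (d1 + d2 + 1) c)
  (hc1 : d1%:R <= \sum_(i < n1) c 0 (lshift n2 i) <= d1%:R + 1)
  (hc2 : d2%:R <= \sum_(j < n2) c 0 (rshift n1 j) <= d2%:R + 1)
  (k : nat) (hk : (0 < k)%N)
  (hkc : forall i, k%:R * c 0 i \is a Num.int)
  (f : 'rV[V]_(n1 + n2) -> R[i])
  (hf : multidegree_invariant (multideg k c) f) :
  exists F : 'rV[subvs_of V1]_(n1 + 1) -> 'rV[subvs_of V2]_(n2 + 1) -> R[i],
    in_tensor (multidegree_invariant (multideg k (attach_left d2 c)))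
              (multidegree_invariant (multideg k (attach_right d1 c))) F /\
    forall (v : 'rV[subvs_of V1]_n1) (w : 'rV[subvs_of V2]_n2),
      f (row_mx (map_mx vsval v) (map_mx vsval w)) =
      F (row_mx v (const_mx (vsproj V1 q))) (row_mx w (const_mx (vsproj V2 q))).
Proof.
have [c01 c_sum] := hc; have c0 i : 0 <= c 0 i by have /andP[] := c01 i.
have aE i : (multideg k c i)%:R = k%:R * c 0 i by apply: multidegE.
have a_sum (I : finType) (t : I -> 'I_(n1 + n2)) :
    (\sum_i multideg k c (t i))%N%:R = k%:R * \sum_i c 0 (t i).
  by rewrite natr_sum mulr_sumr; apply: eq_bigr.
have suml : \sum_j lsubmx c 0 j = \sum_i c 0 (lshift n2 i).
  by apply: eq_bigr => i _; rewrite mxE.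
have sumr : \sum_j rsubmx c 0 j = \sum_i c 0 (rshift n1 i).
  by apply: eq_bigr => i _; rewrite mxE.
have /andP[hc1l _] := hc1; have /andP[hc2l _] := hc2.
(* Taking [b1] and [b2] to be the weights of the attaching point leaves only degree counts, compared
   in [rat], where the truncation in [multideg] is exact. *)
apply: (@attach_decomposition _ V V1 V2 q n1 n2 k
  (multideg k (attach_left d2 c) (rshift n1 ord0))
  (multideg k (attach_right d1 c) (rshift n2 ord0)) (multideg k c)) => //.
- by rewrite hV1 addn1 ltnS.
- by rewrite hV2 addn1 ltnS.
- by apply/eqP; rewrite -(eqr_nat rat) (a_sum _ id) c_sum hV natrM.
- rewrite hV hV2 -addnA addnK; apply/eqP.
  rewrite -(eqr_nat rat) a_sum natrD natrM multideg_attach_right ?suml //.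
  by rewrite /attach_right row_mxEr mxE suml mulrBr addrC subrK.
- rewrite hV hV1 (addnC d1) -addnA addnK; apply/eqP.
  rewrite -(eqr_nat rat) a_sum natrD natrM multideg_attach_left ?sumr //.
  by rewrite /attach_left row_mxEr mxE sumr mulrBr addrC subrK.
- by move=> i; rewrite /multideg /attach_left row_mxEl mxE.
- by move=> i; rewrite /multideg /attach_right row_mxEl mxE.
Qed.
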